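(* Let $k$ be a commutative unital ring, $(W,S)$ a Coxeter system, $A$ a commutative $k$-algebra, $\rho\colon W\to\mathrm{Aut}_{k\text{-alg}}(A)$ an action, and $a\colon S\to A^\times$, $s\mapsto a_s$, a $W$-equivariant map. Assume $A$ is a free $k$-module. Then $\mathcal{E}^{(W,S)}(A,\rho,a)$ is the free $A$-module over the basis $\{g_w\}_{w\in W}$ if and only if for every $s\in S$ $$(1-a_s)(1-\rho_s)=0\quad\text{in }\mathrm{End}_k(A),$$ i.e. $(1-a_s)(c-\rho_s(c))=0$ for all $c\in A$.
   Context: $w.c=\rho_w(c)$ denotes the action. The map $a$ is $W$-equivariant if for all $s_1,s_2\in S$ and $w\in W$ with $ws_1w^{-1}=s_2$ one has $w.a_{s_1}=a_{s_2}$. Let $B_W$ be the Artin braid group of $(W,S)$, with generators $g_s$ ($s\in S$) and the braid relations of $(W,S)$, and let $\pi\colon B_W\to W$ be the canonical projection. The semidirect product $A\rtimes k[B_W]$ is the $k$-algebra generated by $A$ and $B_W$ with relations $gc=(\pi(g).c)g$ for $g\in B_W$, $c\in A$. The Marin ring $\mathcal{E}^{(W,S)}(A,\rho,a)$ is the quotient of $A\rtimes k[B_W]$ by the two-sided ideal generated by the elements $g_s^2-a_s-(1-a_s)g_s$, $s\in S$. It is an $A$-module by left multiplication. For $w\in W$ with reduced expression $w=s_1\cdots s_k$, $s_i\in S$, set $g_w=g_{s_1}\cdots g_{s_k}$ (independent of the reduced expression). *)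

(* Defs.v *)
From HB Require Import structures.
From mathcomp Require Import all_boot all_algebra.
From mathcomp Require Import boolp classical_sets.

Set Implicit Arguments.
Unset Strict Implicit.
Unset Printing Implicit Defensive.

Import GRing.Theory.
Local Open Scope quotient_scope.
Local Open Scope ring_scope.

Section Bases.
Variables (R : pzRingType) (M : lmodType R).

Definition lin_indep (I : choiceType) (e : I -> M) : Prop :=
  forall (s : seq I) (c : I -> R), uniq s ->
    \sum_(i <- s) c i *: e i = 0 -> {in s, forall i, c i = 0}.

Definition spanning (I : choiceType) (e : I -> M) : Prop :=
  forall x : M, exists (s : seq I) (c : I -> R), x = \sum_(i <- s) c i *: e i.

Definition is_basis (I : choiceType) (e : I -> M) : Prop :=
  lin_indep e /\ spanning e.

Definition free_module : Prop :=
  exists (I : choiceType) (e : I -> M), is_basis e.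

End Bases.

Inductive gexpr (X : Type) : Type :=
| GVar of X
| GOne
| GMul of gexpr X & gexpr X
| GInv of gexpr X.
Arguments GOne {X}.

HB.instance Definition _ (X : Type) := gen_eqMixin (gexpr X).
HB.instance Definition _ (X : Type) := gen_choiceMixin (gexpr X).

Fixpoint geval (X : Type) (G : groupType) (f : X -> G) (u : gexpr X) : G :=
  match u with
  | GVar x => f x
  | GOne => 1%g
  | GMul u v => (geval f u * geval f v)%g
  | GInv u => ((geval f u)^-1)%g
  end.

(* The least congruence containing [R] whose quotient is a group. *)
Inductive gcong (X : Type) (R : gexpr X -> gexpr X -> Prop) :
  gexpr X -> gexpr X -> Prop :=
| gcong_rel u v : R u v -> gcong R u v
| gcong_refl u : gcong R u u
| gcong_sym u v : gcong R u v -> gcong R v u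
| gcong_trans u v w : gcong R u v -> gcong R v w -> gcong R u w
| gcong_mul u u' v v' :
    gcong R u u' -> gcong R v v' -> gcong R (GMul u v) (GMul u' v')
| gcong_inv u u' : gcong R u u' -> gcong R (GInv u) (GInv u')
| gcong_mulA u v w : gcong R (GMul u (GMul v w)) (GMul (GMul u v) w)
| gcong_mul1l u : gcong R (GMul GOne u) u
| gcong_mul1r u : gcong R (GMul u GOne) u
| gcong_mulVl u : gcong R (GMul (GInv u) u) GOne
| gcong_mulVr u : gcong R (GMul u (GInv u)) GOne.

(* [f] induces an isomorphism from the group <X | R> onto [G]. *)
Definition presents (X : Type) (R : gexpr X -> gexpr X -> Prop)
    (G : groupType) (f : X -> G) : Prop :=
  (forall g : G, exists u, geval f u = g) /\
  (forall u v, geval f u = geval f v <-> gcong R u v).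

Section PresentedGroup.
Variables (X : Type) (R : gexpr X -> gexpr X -> Prop).

Definition gcongb : rel (gexpr X) := fun u v => `[< gcong R u v >].

Lemma gcongb_refl : reflexive gcongb.
Proof. by move=> u; apply/asboolP; exact: gcong_refl. Qed.

Lemma gcongb_sym : symmetric gcongb.
Proof. by move=> u v; apply/asboolP/asboolP; exact: gcong_sym. Qed.

Lemma gcongb_trans : transitive gcongb.
Proof.
move=> v u w /asboolP uv /asboolP vw; apply/asboolP; exact: gcong_trans vw.
Qed.

Canonical gcong_equiv := EquivRel gcongb gcongb_refl gcongb_sym gcongb_trans.

Definition pgroup : Type := {eq_quot gcong_equiv}.
HB.instance Definition _ := Choice.on pgroup.
HB.instance Definition _ := EqQuotient.on pgroup.

Definition pg_class (u : gexpr X) : pgroup := \pi u.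
Definition pg_one : pgroup := pg_class GOne.
Definition pg_mul (x y : pgroup) : pgroup := pg_class (GMul (repr x) (repr y)).
Definition pg_inv (x : pgroup) : pgroup := pg_class (GInv (repr x)).

Lemma pg_classP u v : pg_class u = pg_class v <-> gcong R u v.
Proof.
split=> [/eqmodP/asboolP //|uv]; by apply/eqmodP/asboolP.
Qed.

Lemma pg_classK x : pg_class (repr x) = x.
Proof. exact: reprK. Qed.

Lemma repr_pg_class u : gcong R (repr (pg_class u)) u.
Proof. by apply/pg_classP; rewrite pg_classK. Qed.

Lemma pg_mulE u v : pg_mul (pg_class u) (pg_class v) = pg_class (GMul u v).
Proof. by apply/pg_classP; apply: gcong_mul; apply: repr_pg_class. Qed.

Lemma pg_invE u : pg_inv (pg_class u) = pg_class (GInv u).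
Proof. by apply/pg_classP; apply: gcong_inv; apply: repr_pg_class. Qed.

Lemma pg_mulA : associative pg_mul.
Proof.
move=> x y z; rewrite -[x]pg_classK -[y]pg_classK -[z]pg_classK !pg_mulE.
exact/pg_classP/gcong_mulA.
Qed.

Lemma pg_mul1l : left_id pg_one pg_mul.
Proof.
by move=> x; rewrite -[x]pg_classK pg_mulE; exact/pg_classP/gcong_mul1l.
Qed.

Lemma pg_mul1r : right_id pg_one pg_mul.
Proof.
by move=> x; rewrite -[x]pg_classK pg_mulE; exact/pg_classP/gcong_mul1r.
Qed.

Lemma pg_mulVl : left_inverse pg_one pg_inv pg_mul.
Proof.
move=> x; rewrite -[x]pg_classK pg_invE pg_mulE.
exact/pg_classP/gcong_mulVl.
Qed.

Lemma pg_mulVr : right_inverse pg_one pg_inv pg_mul.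
Proof.
move=> x; rewrite -[x]pg_classK pg_invE pg_mulE.
exact/pg_classP/gcong_mulVr.
Qed.

HB.instance Definition _ := isGroup.Build pgroup
  pg_mulA pg_mul1l pg_mul1r pg_mulVl pg_mulVr.

Definition pg_gen (x : X) : pgroup := pg_class (GVar x).

(* The map <X | R> -> [G] extending [f]; it is meaningful only when [f]
   satisfies the relations [R] (see [pg_liftM] and [pg_lift_gen]). *)
Definition pg_lift (G : groupType) (f : X -> G) (x : pgroup) : G :=
  geval f (repr x).

Section Lift.
Variables (G : groupType) (f : X -> G).
Hypothesis fR : forall u v, R u v -> geval f u = geval f v.

Lemma geval_gcong u v : gcong R u v -> geval f u = geval f v.
Proof.
elim=> {u v} //=.
- by move=> u v w _ -> _ ->.
- by move=> u u' v v' _ -> _ ->.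
- by move=> u u' _ ->.
- by move=> u v w; rewrite mulgA.
- by move=> u; rewrite mul1g.
- by move=> u; rewrite mulg1.
- by move=> u; rewrite mulVg.
- by move=> u; rewrite mulgV.
Qed.

Lemma pg_lift_class u : pg_lift f (pg_class u) = geval f u.
Proof. exact/geval_gcong/repr_pg_class. Qed.

Lemma pg_lift_gen x : pg_lift f (pg_gen x) = f x.
Proof. exact: pg_lift_class. Qed.

Lemma pg_liftM x y : pg_lift f (x * y)%g = (pg_lift f x * pg_lift f y)%g.
Proof.
by rewrite -[x]pg_classK -[y]pg_classK [(_ * _)%g]pg_mulE !pg_lift_class.
Qed.

Lemma pg_lift1 : pg_lift f 1%g = 1%g.
Proof. exact: pg_lift_class. Qed.
End Lift.

End PresentedGroup.

Definition has_order (G : groupType) (x : G) (m : nat) : Prop :=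
  [/\ (0 < m)%N, (x ^+ m)%g = 1%g
    & forall j, (0 < j < m)%N -> (x ^+ j)%g <> 1%g].

Section Coxeter.
Variables (W : groupType) (S : set W).

(* [(s t)^m = 1] whenever [s t] has finite order [m] in [W]; the case [s = t]
   ([m = 1]) is the relation [s^2 = 1]. *)
Inductive coxeter_rel : gexpr S -> gexpr S -> Prop :=
| CoxeterRel (s t : S) (m : nat) of has_order (val s * val t)%g m :
    coxeter_rel (iter m (GMul (GMul (GVar s) (GVar t))) GOne) GOne.

Definition coxeter_system : Prop :=
  (forall s : S, has_order (val s) 2) /\
  presents coxeter_rel (fun s : S => val s).

(* The alternating product [s t s ...] with [m] factors. *)
Fixpoint alternating (m : nat) (s t : S) : gexpr S :=
  if m is m'.+1 then GMul (GVar s) (alternating m' t s) else GOne.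

Inductive braid_rel : gexpr S -> gexpr S -> Prop :=
| BraidRel (s t : S) (m : nat) of s != t & has_order (val s * val t)%g m :
    braid_rel (alternating m s t) (alternating m t s).

Definition artin_group : groupType := pgroup braid_rel.

Definition artin_gen (s : S) : artin_group := pg_gen braid_rel s.

Definition artin_proj : artin_group -> W :=
  pg_lift (R := braid_rel) (fun s : S => val s).

Definition reduced_expr (w : W) (l : seq S) : Prop :=
  (\prod_(s <- l) val s)%g = w /\
  forall l' : seq S, (\prod_(s <- l') val s)%g = w -> (size l <= size l')%N.

(* A chosen reduced expression of [w]; by Matsumoto's theorem the choice does
   not affect products satisfying the braid relations. In a Coxeter system one
   exists by [reduced_wordP]. *)
Definition reduced_word (w : W) : seq S :=
  xget [::] [set l : seq S | reduced_expr w l].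

Section Facts.
Hypothesis coxS : coxeter_system.

Lemma coxeter_sqr (s : S) : (val s * val s)%g = 1%g.
Proof. by case: coxS => /(_ s)[_ + _] _; rewrite expgS expg1. Qed.

Lemma coxeter_inv (s : S) : ((val s)^-1)%g = val s.
Proof. by apply: (@mulgI _ (val s)); rewrite mulgV coxeter_sqr. Qed.

Lemma geval_alternating m (s t : S) :
  (geval (fun s : S => val s) (alternating m s t) =
   (val s * val t) ^+ m * geval (fun s : S => val s) (alternating m t s))%g.
Proof.
elim: m s t => [|m IHm] s t /=; first by rewrite expg0 mulg1.
rewrite [in LHS]IHm !mulgA; congr (_ * _)%g.
suff -> : ((val s * val t) ^+ m.+1 = val s * (val t * val s) ^+ m * val t)%g.
  by rewrite -!mulgA coxeter_sqr mulg1.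
elim: m {IHm} => [|m IHm]; first by rewrite expg0 expg1 mulg1.
by rewrite expgS IHm [in RHS]expgS !mulgA.
Qed.

Lemma braid_relP u v : braid_rel u v ->
  geval (fun s : S => val s) u = geval (fun s : S => val s) v.
Proof. by case=> s t m _ [_ stm _]; rewrite geval_alternating stm mul1g. Qed.

Lemma artin_projM g h :
  artin_proj (g * h)%g = (artin_proj g * artin_proj h)%g.
Proof. exact: pg_liftM braid_relP _ _. Qed.

Lemma artin_proj1 : artin_proj 1%g = 1%g.
Proof. exact: pg_lift1 braid_relP. Qed.

Lemma artin_proj_gen s : artin_proj (artin_gen s) = val s.
Proof. exact: pg_lift_gen braid_relP _. Qed.

Lemma coxeter_word (w : W) : exists l : seq S, (\prod_(s <- l) val s)%g = w.
Proof.
case: coxS => _ [/(_ w)[u <-] _].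
suff H v : (exists l : seq S, (\prod_(s <- l) val s)%g =
                                geval (fun s : S => val s) v)
           /\ (exists l : seq S, (\prod_(s <- l) val s)%g =
                                ((geval (fun s : S => val s) v)^-1)%g).
  by case: (H u).
elim: v => [s||v1 [[l1 E1] [l1' E1']] v2 [[l2 E2] [l2' E2']]|v [E E']] /=.
- by split; exists [:: s]; rewrite big_seq1 ?coxeter_inv.
- by split; exists [::]; rewrite big_nil ?invg1.
- split; first by exists (l1 ++ l2); rewrite big_cat /= E1 E2.
  by exists (l2' ++ l1'); rewrite big_cat /= E1' E2' invgM.
- by split=> //; rewrite invgK.
Qed.

Lemma reduced_wordP (w : W) : reduced_expr w (reduced_word w).
Proof.
apply: xgetPex.
have exn : exists n, `[< exists l : seq S,
    (\prod_(s <- l) val s)%g = w /\ size l = n >].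
  by have [l lw] := coxeter_word w; exists (size l); apply/asboolP; exists l.
case: (ex_minnP exn) => n /asboolP[l [lw <-]] lmin.
by exists l; split=> // l' l'w; apply: lmin; apply/asboolP; exists l'.
Qed.

End Facts.
End Coxeter.

(* A commutative [k]-algebra is a commutative ring [A] with a ring morphism
   [eta : k -> A]; this is [A] with the resulting [k]-module structure.
   MathComp's [comAlgType k] is not used because it requires 1 != 0 in [A]. *)
Definition alg_module (k A : comPzRingType) (eta : {rmorphism k -> A}) : Type :=
  A.

Section AlgModule.
Variables (k A : comPzRingType) (eta : {rmorphism k -> A}).

HB.instance Definition _ := GRing.Zmodule.on (alg_module eta).

Definition alg_scale (z : k) (c : alg_module eta) : alg_module eta :=
  eta z * (c : A).

Lemma alg_scaleA z t c : alg_scale z (alg_scale t c) = alg_scale (z * t) c.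
Proof. by rewrite /alg_scale rmorphM mulrA. Qed.

Lemma alg_scale1 : left_id 1 alg_scale.
Proof. by move=> c; rewrite /alg_scale rmorph1 mul1r. Qed.

Lemma alg_scaleDr : right_distributive alg_scale +%R.
Proof. by move=> z c d; rewrite /alg_scale mulrDr. Qed.

Lemma alg_scaleDl c : {morph alg_scale^~ c : z t / z + t}.
Proof. by move=> z t; rewrite /alg_scale rmorphD mulrDl. Qed.

HB.instance Definition _ := GRing.Zmodule_isLmodule.Build k (alg_module eta)
  alg_scaleA alg_scale1 alg_scaleDr alg_scaleDl.
End AlgModule.

Inductive aexpr (k X : Type) : Type :=
| AVar of X
| AScal of k
| AAdd of aexpr k X & aexpr k X
| AMul of aexpr k X & aexpr k X.
Arguments AVar {k X}.
Arguments AScal {k X}.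

HB.instance Definition _ (k X : Type) := gen_eqMixin (aexpr k X).
HB.instance Definition _ (k X : Type) := gen_choiceMixin (aexpr k X).

(* The least congruence containing [R] whose quotient is a [k]-algebra, that
   is, a ring with a central ring morphism [AScal] from [k]. *)
Inductive acong (k : comPzRingType) (X : Type)
  (R : aexpr k X -> aexpr k X -> Prop) : aexpr k X -> aexpr k X -> Prop :=
| acong_rel u v : R u v -> acong R u v
| acong_refl u : acong R u u
| acong_sym u v : acong R u v -> acong R v u
| acong_trans u v w : acong R u v -> acong R v w -> acong R u w
| acong_add u u' v v' :
    acong R u u' -> acong R v v' -> acong R (AAdd u v) (AAdd u' v')
| acong_mul u u' v v' :
    acong R u u' -> acong R v v' -> acong R (AMul u v) (AMul u' v')
| acong_addA u v w : acong R (AAdd u (AAdd v w)) (AAdd (AAdd u v) w)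
| acong_addC u v : acong R (AAdd u v) (AAdd v u)
| acong_add0 u : acong R (AAdd (AScal 0) u) u
| acong_addN u : acong R (AAdd (AMul (AScal (-1)) u) u) (AScal 0)
| acong_mulA u v w : acong R (AMul u (AMul v w)) (AMul (AMul u v) w)
| acong_mul1l u : acong R (AMul (AScal 1) u) u
| acong_mul1r u : acong R (AMul u (AScal 1)) u
| acong_mulDl u v w : acong R (AMul (AAdd u v) w) (AAdd (AMul u w) (AMul v w))
| acong_mulDr u v w : acong R (AMul u (AAdd v w)) (AAdd (AMul u v) (AMul u w))
| acong_scalD z t : acong R (AScal (z + t)) (AAdd (AScal z) (AScal t))
| acong_scalM z t : acong R (AScal (z * t)) (AMul (AScal z) (AScal t))
| acong_scalC z u : acong R (AMul (AScal z) u) (AMul u (AScal z)).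

Section PresentedAlgebra.
Variables (k : comPzRingType) (X : Type).
Variable R : aexpr k X -> aexpr k X -> Prop.

Definition acongb : rel (aexpr k X) := fun u v => `[< acong R u v >].

Lemma acongb_refl : reflexive acongb.
Proof. by move=> u; apply/asboolP; exact: acong_refl. Qed.

Lemma acongb_sym : symmetric acongb.
Proof. by move=> u v; apply/asboolP/asboolP; exact: acong_sym. Qed.

Lemma acongb_trans : transitive acongb.
Proof.
move=> v u w /asboolP uv /asboolP vw; apply/asboolP; exact: acong_trans vw.
Qed.

Canonical acong_equiv := EquivRel acongb acongb_refl acongb_sym acongb_trans.

Definition palg : Type := {eq_quot acong_equiv}.
HB.instance Definition _ := Choice.on palg.
HB.instance Definition _ := EqQuotient.on palg.

Definition pa_class (u : aexpr k X) : palg := \pi u.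
Definition pa_gen (x : X) : palg := pa_class (AVar x).
Definition pa_scal (z : k) : palg := pa_class (AScal z).
Definition pa_add (x y : palg) : palg := pa_class (AAdd (repr x) (repr y)).
Definition pa_mul (x y : palg) : palg := pa_class (AMul (repr x) (repr y)).
Definition pa_opp (x : palg) : palg := pa_mul (pa_scal (-1)) x.

Lemma pa_classP u v : pa_class u = pa_class v <-> acong R u v.
Proof. by split=> [/eqmodP/asboolP //|uv]; apply/eqmodP/asboolP. Qed.

Lemma pa_classK x : pa_class (repr x) = x.
Proof. exact: reprK. Qed.

Lemma repr_pa_class u : acong R (repr (pa_class u)) u.
Proof. by apply/pa_classP; rewrite pa_classK. Qed.

Lemma pa_addE u v : pa_add (pa_class u) (pa_class v) = pa_class (AAdd u v).
Proof. by apply/pa_classP; apply: acong_add; apply: repr_pa_class. Qed.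

Lemma pa_mulE u v : pa_mul (pa_class u) (pa_class v) = pa_class (AMul u v).
Proof. by apply/pa_classP; apply: acong_mul; apply: repr_pa_class. Qed.

Lemma pa_classW (P : palg -> Prop) : (forall u, P (pa_class u)) -> forall x, P x.
Proof. by move=> PP x; rewrite -[x]pa_classK. Qed.

Lemma pa_addA : associative pa_add.
Proof.
elim/pa_classW=> u; elim/pa_classW=> v; elim/pa_classW=> w; rewrite !pa_addE.
exact/pa_classP/acong_addA.
Qed.

Lemma pa_addC : commutative pa_add.
Proof.
elim/pa_classW=> u; elim/pa_classW=> v; rewrite !pa_addE.
exact/pa_classP/acong_addC.
Qed.

Lemma pa_add0 : left_id (pa_scal 0) pa_add.
Proof. elim/pa_classW=> u; rewrite pa_addE; exact/pa_classP/acong_add0. Qed.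

Lemma pa_addN : left_inverse (pa_scal 0) pa_opp pa_add.
Proof.
elim/pa_classW=> u; rewrite /pa_opp pa_mulE pa_addE.
exact/pa_classP/acong_addN.
Qed.

Lemma pa_mulA : associative pa_mul.
Proof.
elim/pa_classW=> u; elim/pa_classW=> v; elim/pa_classW=> w; rewrite !pa_mulE.
exact/pa_classP/acong_mulA.
Qed.

Lemma pa_mul1l : left_id (pa_scal 1) pa_mul.
Proof. elim/pa_classW=> u; rewrite pa_mulE; exact/pa_classP/acong_mul1l. Qed.

Lemma pa_mul1r : right_id (pa_scal 1) pa_mul.
Proof. elim/pa_classW=> u; rewrite pa_mulE; exact/pa_classP/acong_mul1r. Qed.

Lemma pa_mulDl : left_distributive pa_mul pa_add.
Proof.
elim/pa_classW=> u; elim/pa_classW=> v; elim/pa_classW=> w.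
by rewrite !(pa_addE, pa_mulE); exact/pa_classP/acong_mulDl.
Qed.

Lemma pa_mulDr : right_distributive pa_mul pa_add.
Proof.
elim/pa_classW=> u; elim/pa_classW=> v; elim/pa_classW=> w.
by rewrite !(pa_addE, pa_mulE); exact/pa_classP/acong_mulDr.
Qed.

HB.instance Definition _ := GRing.isPzRing.Build palg
  pa_addA pa_addC pa_add0 pa_addN
  pa_mulA pa_mul1l pa_mul1r pa_mulDl pa_mulDr.

Lemma pa_classD u v : pa_class (AAdd u v) = pa_class u + pa_class v.
Proof. by rewrite -pa_addE. Qed.

Lemma pa_classM u v : pa_class (AMul u v) = pa_class u * pa_class v.
Proof. by rewrite -pa_mulE. Qed.

Lemma pa_scalC z x : pa_scal z * x = x * pa_scal z.
Proof.
elim/pa_classW: x => u; rewrite -!pa_classM; exact/pa_classP/acong_scalC.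
Qed.

End PresentedAlgebra.

Inductive ideal2 (E : pzRingType) (X : E -> Prop) : E -> Prop :=
| ideal2_gen x : X x -> ideal2 X x
| ideal2_0 : ideal2 X 0
| ideal2_D x y : ideal2 X x -> ideal2 X y -> ideal2 X (x + y)
| ideal2_Ml r x : ideal2 X x -> ideal2 X (r * x)
| ideal2_Mr r x : ideal2 X x -> ideal2 X (x * r).

Section IdealQuotient.
Variables (E : pzRingType) (X : E -> Prop).

Lemma ideal2_N x : ideal2 X x -> ideal2 X (- x).
Proof. by rewrite -mulN1r; exact: ideal2_Ml. Qed.

Definition idealb : rel E := fun x y => `[< ideal2 X (x - y) >].

Lemma idealb_refl : reflexive idealb.
Proof. by move=> x; apply/asboolP; rewrite subrr; exact: ideal2_0. Qed.

Lemma idealb_sym : symmetric idealb.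
Proof.
by move=> x y; apply/asboolP/asboolP => /ideal2_N; rewrite opprB.
Qed.

Lemma idealb_trans : transitive idealb.
Proof.
move=> y x z /asboolP xy /asboolP yz; apply/asboolP.
by rewrite -(subrK y x) -addrA; exact: ideal2_D.
Qed.

Canonical ideal_equiv := EquivRel idealb idealb_refl idealb_sym idealb_trans.

Definition quot2 : Type := {eq_quot ideal_equiv}.
HB.instance Definition _ := Choice.on quot2.
HB.instance Definition _ := EqQuotient.on quot2.

Definition q2_class (x : E) : quot2 := \pi x.
Definition q2_add (x y : quot2) : quot2 := q2_class (repr x + repr y).
Definition q2_mul (x y : quot2) : quot2 := q2_class (repr x * repr y).
Definition q2_opp (x : quot2) : quot2 := q2_class (- repr x).

Lemma q2_classP x y : q2_class x = q2_class y <-> ideal2 X (x - y).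
Proof. by split=> [/eqmodP/asboolP //|xy]; apply/eqmodP/asboolP. Qed.

Lemma q2_classK x : q2_class (repr x) = x.
Proof. exact: reprK. Qed.

Lemma repr_q2_class x : ideal2 X (repr (q2_class x) - x).
Proof. by apply/q2_classP; rewrite q2_classK. Qed.

Lemma q2_addE x y : q2_add (q2_class x) (q2_class y) = q2_class (x + y).
Proof.
by apply/q2_classP; rewrite opprD addrACA; apply: ideal2_D; apply: repr_q2_class.
Qed.

Lemma q2_oppE x : q2_opp (q2_class x) = q2_class (- x).
Proof.
by apply/q2_classP; rewrite -opprD; apply: ideal2_N; apply: repr_q2_class.
Qed.

Lemma q2_mulE x y : q2_mul (q2_class x) (q2_class y) = q2_class (x * y).
Proof.
apply/q2_classP; set x' := repr _; set y' := repr _.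
have -> : x' * y' - x * y = (x' - x) * y' + x * (y' - y).
  by rewrite mulrBl mulrBr addrA subrK.
apply: ideal2_D; first exact/ideal2_Mr/repr_q2_class.
exact/ideal2_Ml/repr_q2_class.
Qed.

Lemma q2_classW (P : quot2 -> Prop) : (forall x, P (q2_class x)) -> forall x, P x.
Proof. by move=> PP x; rewrite -[x]q2_classK. Qed.

Lemma q2_addA : associative q2_add.
Proof.
elim/q2_classW=> x; elim/q2_classW=> y; elim/q2_classW=> z.
by rewrite !q2_addE addrA.
Qed.

Lemma q2_addC : commutative q2_add.
Proof. by elim/q2_classW=> x; elim/q2_classW=> y; rewrite !q2_addE addrC. Qed.

Lemma q2_add0 : left_id (q2_class 0) q2_add.
Proof. by elim/q2_classW=> x; rewrite q2_addE add0r. Qed.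

Lemma q2_addN : left_inverse (q2_class 0) q2_opp q2_add.
Proof. by elim/q2_classW=> x; rewrite q2_oppE q2_addE addNr. Qed.

Lemma q2_mulA : associative q2_mul.
Proof.
elim/q2_classW=> x; elim/q2_classW=> y; elim/q2_classW=> z.
by rewrite !q2_mulE mulrA.
Qed.

Lemma q2_mul1l : left_id (q2_class 1) q2_mul.
Proof. by elim/q2_classW=> x; rewrite q2_mulE mul1r. Qed.

Lemma q2_mul1r : right_id (q2_class 1) q2_mul.
Proof. by elim/q2_classW=> x; rewrite q2_mulE mulr1. Qed.

Lemma q2_mulDl : left_distributive q2_mul q2_add.
Proof.
elim/q2_classW=> x; elim/q2_classW=> y; elim/q2_classW=> z.
by rewrite !(q2_addE, q2_mulE) mulrDl.
Qed.

Lemma q2_mulDr : right_distributive q2_mul q2_add.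
Proof.
elim/q2_classW=> x; elim/q2_classW=> y; elim/q2_classW=> z.
by rewrite !(q2_addE, q2_mulE) mulrDr.
Qed.

HB.instance Definition _ := GRing.isPzRing.Build quot2
  q2_addA q2_addC q2_add0 q2_addN
  q2_mulA q2_mul1l q2_mul1r q2_mulDl q2_mulDr.

Lemma q2_classD x y : q2_class (x + y) = q2_class x + q2_class y.
Proof. by rewrite -q2_addE. Qed.

Lemma q2_classM x y : q2_class (x * y) = q2_class x * q2_class y.
Proof. by rewrite -q2_mulE. Qed.

Lemma q2_class1 : q2_class 1 = 1.
Proof. by []. Qed.

End IdealQuotient.

(* [rho] is a morphism from [W] to the group of [k]-algebra automorphisms of
   [A]; bijectivity of each [rho w] follows from the group action laws. *)
Record alg_action (k A : comPzRingType) (eta : {rmorphism k -> A})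
    (W : groupType) (rho : W -> A -> A) : Prop := AlgAction {
  alg_action1 : forall c, rho 1%g c = c;
  alg_actionM : forall v w c, rho (v * w)%g c = rho v (rho w c);
  alg_action_add : forall w c d, rho w (c + d) = rho w c + rho w d;
  alg_action_one : forall w, rho w 1 = 1;
  alg_action_mul : forall w c d, rho w (c * d) = rho w c * rho w d;
  alg_action_scal : forall w z, rho w (eta z) = eta z
}.

Definition invertible (A : comPzRingType) (c : A) : Prop :=
  exists d : A, c * d = 1.

Definition equivariant (W : groupType) (S : set W) (A : Type)
    (rho : W -> A -> A) (a : S -> A) : Prop :=
  forall (s1 s2 : S) (w : W),
    (w * val s1 * w^-1)%g = val s2 -> rho w (a s1) = a s2.

Section Marin.
Variables (k A : comPzRingType) (eta : {rmorphism k -> A}).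
Variables (W : groupType) (S : set W) (rho : W -> A -> A) (a : S -> A).

Local Notation B := (artin_group S).
Local Notation genA c := (AVar (inl c : A + B)).
Local Notation genB g := (AVar (inr g : A + B)).

(* The first four relations are those of the [k]-algebra [A], the next two
   those of the group [B]. *)
Inductive semidirect_rel : aexpr k (A + B) -> aexpr k (A + B) -> Prop :=
| sd_A_add c d : semidirect_rel (genA (c + d)) (AAdd (genA c) (genA d))
| sd_A_mul c d : semidirect_rel (genA (c * d)) (AMul (genA c) (genA d))
| sd_A_one : semidirect_rel (genA 1) (AScal 1)
| sd_A_scal z : semidirect_rel (genA (eta z)) (AScal z)
| sd_B_mul g h : semidirect_rel (genB (g * h)%g) (AMul (genB g) (genB h))
| sd_B_one : semidirect_rel (genB 1%g) (AScal 1)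
| sd_comm g c :
    semidirect_rel (AMul (genB g) (genA c))
                   (AMul (genA (rho (artin_proj g) c)) (genB g)).

Definition semidirect : pzRingType := palg semidirect_rel.

Definition sd_A (c : A) : semidirect := pa_gen semidirect_rel (inl c).
Definition sd_B (g : B) : semidirect := pa_gen semidirect_rel (inr g).

Inductive marin_rel : semidirect -> Prop :=
| MarinRel s (gs := sd_B (artin_gen s)) :
    marin_rel (gs ^+ 2 - sd_A (a s) - (1 - sd_A (a s)) * gs).

Definition marin : Type := quot2 marin_rel.
HB.instance Definition _ := GRing.PzRing.on marin.

Definition marin_class (x : semidirect) : marin := q2_class marin_rel x.

(* The only module structure declared on [marin] is left multiplication by [A];
   [k] acts through [eta]. *)
Definition marin_scale (c : A) (x : marin) : marin := marin_class (sd_A c) * x.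

Lemma marin_scaleA c d x :
  marin_scale c (marin_scale d x) = marin_scale (c * d) x.
Proof.
rewrite /marin_scale mulrA -[_ * marin_class _]q2_classM; congr (_ * _).
congr marin_class; rewrite /sd_A /pa_gen -pa_classM.
by apply/pa_classP/acong_sym/acong_rel; constructor.
Qed.

Lemma marin_scale1 : left_id 1 marin_scale.
Proof.
move=> x; rewrite /marin_scale.
suff -> : sd_A 1 = 1 by rewrite [marin_class 1]q2_class1 mul1r.
by apply/pa_classP/acong_rel; constructor.
Qed.

Lemma marin_scaleDr : right_distributive marin_scale +%R.
Proof. by move=> c x y; rewrite /marin_scale mulrDr. Qed.

Lemma marin_scaleDl x : {morph marin_scale^~ x : c d / c + d}.
Proof.
move=> c d; rewrite /marin_scale -mulrDl; congr (_ * _).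
transitivity (marin_class (sd_A c + sd_A d)); last exact: q2_classD.
congr marin_class; rewrite /sd_A /pa_gen -pa_classD.
by apply/pa_classP/acong_rel; constructor.
Qed.

HB.instance Definition _ := GRing.Zmodule_isLmodule.Build A marin
  marin_scaleA marin_scale1 marin_scaleDr marin_scaleDl.

Definition marin_gen (s : S) : marin := marin_class (sd_B (artin_gen s)).

Definition marin_basis (w : W) : marin :=
  \prod_(s <- reduced_word S w) marin_gen s.

End Marin.

(* Main.v *)
From HB Require Import structures.
Require Import Defs.
From mathcomp Require Import all_boot all_algebra.
From mathcomp Require Import boolp classical_sets.
From mathcomp Require Import ring zify.

(* Multiplying [g_s g_s c] in two ways gives [(1 - a_s)(c - s(c)) g_s = 0], so the
   condition is necessary as soon as [g_s] is free over [A].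

   Conversely, the [g_w] span because, by Matsumoto's theorem, left
   multiplication by [g_s] sends [g_w] to [g_(sw)] when [l(sw) > l(w)], and to
   [a_s g_(sw) + (1 - a_s) g_w] otherwise.  For independence, [g_s] is made to
   act on all functions [W -> A] by an operator [T_s].  The condition and the
   equivariance of [a] make the [T_s] commute with operators [R_t] modelled on
   right multiplication; since the [R_t] move the value at 1 to any other
   point, the braid relations need only be checked at 1, where
   [(T_(s_1) ... T_(s_n) f)(1) = w(f(w^-1))] for a reduced expression of [w].
   The same formula separates the [g_w].

   The combinatorics of [W] (exchange condition, Matsumoto's theorem) is
   extracted from the presentation by letting [W] act on [W x bool]: [s]
   conjugates the first component and flips the sign at [s]. *)

Set Implicit Arguments.
Unset Strict Implicit.
Unset Printing Implicit Defensive.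

Import GRing.Theory.
Local Open Scope ring_scope.

(** * The group of bijections of a type *)

Record bijection (T : Type) := Bijection {
  bij_fun :> T -> T;
  bij_inv : T -> T;
  bij_funK : cancel bij_fun bij_inv;
  bij_invK : cancel bij_inv bij_fun }.

HB.instance Definition _ (T : Type) := gen_eqMixin (bijection T).
HB.instance Definition _ (T : Type) := gen_choiceMixin (bijection T).

Section BijectionGroup.
Variable T : Type.
Implicit Types f g h : bijection T.

Lemma bijectionP f g : bij_fun f =1 bij_fun g -> f = g.
Proof.
case: f g => [f f' fK f'K] [g g' gK g'K] /= /funext fg.
subst g; have fg' : f' = g' by apply/funext => x; rewrite -[x in LHS]g'K fK.
by subst g'; congr Bijection; apply: Prop_irrelevance.
Qed.

Definition bij_one : bijection T := @Bijection T id id (@erefl T) (@erefl T).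
Definition bij_mul f g : bijection T :=
  Bijection (can_comp (bij_funK f) (bij_funK g))
            (can_comp (bij_invK g) (bij_invK f)).
Definition bij_opp f : bijection T := Bijection (bij_invK f) (bij_funK f).

Lemma bij_mulA : associative bij_mul.
Proof. by move=> f g h; apply: bijectionP. Qed.
Lemma bij_mul1l : left_id bij_one bij_mul.
Proof. by move=> f; apply: bijectionP. Qed.
Lemma bij_mul1r : right_id bij_one bij_mul.
Proof. by move=> f; apply: bijectionP. Qed.
Lemma bij_mulVl : left_inverse bij_one bij_opp bij_mul.
Proof. by move=> f; apply: bijectionP => x /=; rewrite bij_funK. Qed.
Lemma bij_mulVr : right_inverse bij_one bij_opp bij_mul.
Proof. by move=> f; apply: bijectionP => x /=; rewrite bij_invK. Qed.

HB.instance Definition _ := isGroup.Build (bijection T)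
  bij_mulA bij_mul1l bij_mul1r bij_mulVl bij_mulVr.

Lemma bijM f g x : (f * g)%g x = f (g x). Proof. by []. Qed.
Lemma bij1 x : (1%g : bijection T) x = x. Proof. by []. Qed.
Lemma bijV f x : (f^-1)%g x = bij_inv f x. Proof. by []. Qed.

End BijectionGroup.

(** * Words in the generators and the presentation of [W] *)

Section CoxeterCombinatorics.
Variables (W : groupType) (S : set W).
Hypothesis coxS : coxeter_system S.
Implicit Types (s t : S) (l : seq S) (r v w : W).
Local Open Scope group_scope.

Local Notation wprod l := (\prod_(s <- l) val s).
Let ss s : val s * val s = 1 := coxeter_sqr coxS s.
Let sV s : (val s)^-1 = val s := coxeter_inv coxS s.

Lemma wprod_cons s l : wprod (s :: l) = val s * wprod l.
Proof. exact: big_cons. Qed.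

Lemma wprod_cat l l' : wprod (l ++ l') = wprod l * wprod l'.
Proof. exact: big_cat. Qed.

Lemma wprod_rcons l s : wprod (rcons l s) = wprod l * val s.
Proof. exact: big_rcons. Qed.

Lemma wprod_rev l : wprod (rev l) = (wprod l)^-1.
Proof.
elim: l => [|s l IHl]; first by rewrite !big_nil invg1.
by rewrite rev_cons wprod_rcons IHl wprod_cons invgM sV.
Qed.

Definition word_expr l : gexpr S := foldr (fun s => GMul (GVar s)) GOne l.

Lemma geval_word_expr (G : groupType) (f : S -> G) l :
  geval f (word_expr l) = \prod_(s <- l) f s.
Proof. by elim: l => [|s l IHl] /=; rewrite (big_nil, big_cons) // IHl. Qed.

(** By the presentation, words with equal products are congruent modulo the Coxeter relations, which
    [f] respects. *)
Lemma coxeter_universal (G : groupType) (f : S -> G) l l' :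
  (forall s t m, has_order (val s * val t) m -> (f s * f t) ^+ m = 1) ->
  wprod l = wprod l' -> \prod_(s <- l) f s = \prod_(s <- l') f s.
Proof.
move=> fR; rewrite -!geval_word_expr; case: coxS => _ [_ presS] /presS.
apply: geval_gcong => _ _ [s t m st_m] /=; rewrite -(fR s t m st_m).
by elim: {st_m} m => [|m IHm]; rewrite ?expg0 //= IHm expgS.
Qed.

(** * The signed conjugation action and the exchange condition *)

Definition flip_fun s (p : W * bool) : W * bool :=
  (val s * p.1 * val s, p.2 (+) (p.1 == val s)).

(** Conjugation by [s] sends [s], and nothing else, to [s], so the sign changes twice or never. *)
Lemma flip_funK s : involutive (flip_fun s).
Proof.
case=> r e; rewrite /flip_fun /= !mulgA ss mul1g -mulgA ss mulg1.
congr pair; suff -> : (val s * r * val s == val s) = (r == val s).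
  by rewrite -addbA addbb addbF.
apply/eqP/eqP => [E|->]; last by rewrite ss mul1g.
have : val s * (val s * r * val s) * val s = val s * val s * val s by rewrite E.
by rewrite !mulgA ss !mul1g -mulgA ss mulg1.
Qed.

Definition flip s : bijection (W * bool) :=
  Bijection (flip_funK s) (flip_funK s).

(* The reflections passed by [(s t)^m] are the [(t s)^j t] for [j < 2 m]; when
   [(s t)^m = 1] each of them occurs twice. *)
Lemma flip_expg s t m r e :
  ((flip s * flip t) ^+ m) (r, e) =
  ((val s * val t) ^+ m * r * (val t * val s) ^+ m,
   e (+) odd (count (fun j => r == (val t * val s) ^+ j * val t)
                    (iota 0 m.*2))).
Proof.
elim: m => [|m IHm]; first by rewrite !expg0 mul1g mulg1 addbF.
rewrite doubleS -[m.*2.+2]addn2 iotaD count_cat expgS bijM IHm bijM.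
rewrite /= /flip_fun /=.
set x := val s; set y := val t.
have yy : y * y = 1 := ss t.
have xyV j : ((y * x) ^+ j)^-1 = (x * y) ^+ j by rewrite -expVgn invgM !sV.
have xyK j : (x * y) ^+ j * (y * x) ^+ j = 1 by rewrite -xyV mulVg.
have yxK j : (y * x) ^+ j * (x * y) ^+ j = 1 by rewrite -xyV mulgV.
have shift j : y * (x * y) ^+ j = (y * x) ^+ j * y.
  elim: j => [|j IHj]; first by rewrite !expg0 mulg1 mul1g.
  by rewrite expgSr mulgA IHj expgSr !mulgA.
have conj z : ((x * y) ^+ m * r * (y * x) ^+ m == z) =
              (r == (y * x) ^+ m * z * (x * y) ^+ m).
  apply/eqP/eqP => [<-|->].
    by rewrite !mulgA yxK mul1g -mulgA yxK mulg1.
  by rewrite !mulgA xyK mul1g -mulgA xyK mulg1.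
congr pair.
  by rewrite [(x * y) ^+ m.+1]expgS [(y * x) ^+ m.+1]expgSr !mulgA.
(* The new indices [m.*2] and [m.*2.+1] record the sign changes made by the last [flip t] and
   [flip s]. *)
rewrite add0n addn0 oddD !oddD !oddb.
rewrite -!addbA; congr (_ (+) (_ (+) (_ (+) _))).
  by rewrite conj -mulgA shift mulgA -expgnDr addnn.
have conjy z u : (y * z * y == u) = (z == y * u * y).
  by apply/eqP/eqP => [<-|->]; rewrite !mulgA yy mul1g -mulgA yy mulg1.
rewrite conjy conj -!mulgA shift !mulgA -[_ * y * x]mulgA -expgSr -expgnDr.
by rewrite addSn addnn.
Qed.

Lemma flip_relation s t m :
  has_order (val s * val t) m -> (flip s * flip t) ^+ m = 1.
Proof.
case=> _ stm _; have tsm : (val t * val s) ^+ m = 1.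
  by apply: invg_inj; rewrite -expVgn invgM !sV stm invg1.
apply: bijectionP => -[r e]; rewrite flip_expg stm tsm mul1g mulg1 bij1.
rewrite -addnn iotaD count_cat add0n -[in iota m m](addn0 m) iotaDl count_map.
rewrite (@eq_count _ (preim _ _) (fun j => r == (val t * val s) ^+ j * val t)).
  by rewrite oddD addn0 addbb addbF.
by move=> j /=; rewrite expgnDr tsm mul1g.
Qed.

(* [linv l r] is the parity of the number of factorizations
   [l = l1 ++ s :: l2] with [r = l1 s l1^-1]. *)
Fixpoint linv l r : bool :=
  if l is s :: l' then (r == val s) (+) linv l' (val s * r * val s) else false.

(** This exhibits [linv] as the sign part of a group action, whence it depends only on the product
    of the word. *)
Lemma flip_word l r e :
  ((\prod_(s <- l) flip s)^-1) (r, e) =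
  ((wprod l)^-1 * r * wprod l, e (+) linv l r).
Proof.
elim: l r e => [|s l IHl] r e.
  by rewrite !big_nil !invg1 bij1 mul1g mulg1 addbF.
rewrite !big_cons !invgM bijM.
have -> : (flip s)^-1 (r, e) = flip_fun s (r, e) by [].
by rewrite IHl /= sV !mulgA addbA.
Qed.

Lemma linv_wprod l l' : wprod l = wprod l' -> linv l =1 linv l'.
Proof.
move=> ll' r; have := flip_word l r false.
by rewrite (coxeter_universal flip_relation ll') flip_word ll' => -[].
Qed.

Lemma linv_cat l l' r :
  linv (l ++ l') r = linv l r (+) linv l' ((wprod l)^-1 * r * wprod l).
Proof.
elim: l r => [|s l IHl] r /=; first by rewrite big_nil invg1 mul1g mulg1.
by rewrite IHl big_cons invgM sV !mulgA addbA.
Qed.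

(** An odd number of factorizations is not zero, and multiplying by [l1 s l1^-1] on the left deletes
    the letter [s] after [l1]. *)
Lemma linv_exchange l r : linv l r ->
  exists l1 s l2, l = l1 ++ s :: l2 /\ r * wprod l = wprod (l1 ++ l2).
Proof.
elim: l r => [//|s l IHl] r /=; case: eqP => [->|_] /= => [_|/IHl].
  by exists [::], s, l; rewrite wprod_cons mulgA ss mul1g.
case=> l1 [t [l2 [-> E]]]; exists (s :: l1), t, l2; split=> //.
by rewrite cat_cons !wprod_cons -E !mulgA ss mul1g.
Qed.

(** * Reduced words *)

Definition reduced l : Prop := reduced_expr (wprod l) l.

Lemma reducedP l :
  reduced l <-> forall l', wprod l' = wprod l -> (size l <= size l')%N.
Proof. by split=> [[]|]. Qed.

Lemma reduced_catl l l' : reduced (l ++ l') -> reduced l.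
Proof.
move=> /reducedP red; apply/reducedP => u ul.
have := red (u ++ l'); rewrite !wprod_cat ul !size_cat => /(_ erefl).
by rewrite leq_add2r.
Qed.

Lemma reduced_catr l l' : reduced (l ++ l') -> reduced l'.
Proof.
move=> /reducedP red; apply/reducedP => u ul.
have := red (l ++ u); rewrite !wprod_cat ul !size_cat => /(_ erefl).
by rewrite leq_add2l.
Qed.

Lemma reduced_rev l : reduced l -> reduced (rev l).
Proof.
move=> /reducedP red; apply/reducedP => u.
rewrite wprod_rev size_rev -(size_rev u) => ul.
by apply: red; rewrite wprod_rev ul invgK.
Qed.

Lemma reduced_eq_size l l' :
  reduced l -> wprod l' = wprod l -> size l' = size l -> reduced l'.
Proof. by move=> /reducedP red E sz; apply/reducedP; rewrite E sz. Qed.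

Lemma reduced_nil : reduced [::].
Proof. exact/reducedP. Qed.

(** If [s] is an inversion of [l], exchange gives a word for [s l] shorter than [l]. If not, [s] is
    an inversion of every word [u] for [s l], and exchange in [u] gives a word for [l] shorter than
    [u]. *)
Lemma reduced_cons s l : reduced l -> reduced (s :: l) <-> ~~ linv l (val s).
Proof.
move=> /reducedP red; split=> [/reducedP reds|].
  apply/negP => /linv_exchange[l1 [t [l2 [El E]]]].
  have := reds (l1 ++ l2); rewrite -E wprod_cons => /(_ erefl).
  by rewrite /= El !size_cat /=; lia.
move=> Nsl; apply/reducedP => u usl.
have lu : wprod l = wprod (s :: u).
  by rewrite wprod_cons usl wprod_cons mulgA ss mul1g.
have : linv u (val s).
  have := linv_wprod lu (val s).
  by rewrite (negbTE Nsl) /= eqxx ss mul1g; case: (linv u _).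
case/linv_exchange=> u1 [t [u2 [Eu E]]].
have := red (u1 ++ u2); rewrite -E lu wprod_cons => /(_ erefl).
by rewrite Eu !size_cat /= addnS.
Qed.

(** * Alternating words and the order of [s t] *)

Fixpoint altw m s t : seq S := if m is m'.+1 then s :: altw m' t s else [::].

Lemma size_altw m s t : size (altw m s t) = m.
Proof. by elim: m s t => //= m IHm s t; rewrite IHm. Qed.

Lemma alternatingE m s t : alternating m s t = word_expr (altw m s t).
Proof. by elim: m s t => //= m IHm s t; rewrite IHm. Qed.

Lemma altw_cat m n s t :
  exists2 l, altw (m + n) s t = altw m s t ++ l & size l = n.
Proof.
elim: m s t => [|m IHm] s t; first by exists (altw n s t); rewrite ?size_altw.
by have [l E sz] := IHm t s; exists l; rewrite //= E.
Qed.

Lemma wprod_altw m s t :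
  wprod (altw m s t) = (val s * val t) ^+ m * wprod (altw m t s).
Proof.
by have := geval_alternating coxS m s t; rewrite !alternatingE !geval_word_expr.
Qed.

Lemma linv_altw k s t r : linv (altw k s t) r ->
  exists2 i, (i < k)%N & r = (val s * val t) ^+ i * val s.
Proof.
elim: k s t r => [//|k IHk] s t r /=; case: eqP => [-> _|_ /= /IHk[i ik E]].
  by exists 0%N; rewrite ?expg0 ?mul1g.
exists i.+1 => //; have -> : r = val s * (val s * r * val s) * val s.
  by rewrite !mulgA ss mul1g -mulgA ss mulg1.
rewrite E; congr (_ * _); elim: i {ik E} => [|i IHi].
  by rewrite expg0 mul1g expg1.
by rewrite expgS [in RHS]expgS -IHi !mulgA.
Qed.

(** If prepending [s] broke reducedness, then [s = (t s)^i t] for some [i < k], that is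
    [(t s)^(i+1) = 1], against the bound on the order. *)
Lemma altw_reduced k s t :
  (forall j, (0 < j < k)%N -> (val s * val t) ^+ j <> 1) ->
  reduced (altw k s t).
Proof.
elim: k s t => [|k IHk] s t stk; first exact: reduced_nil.
have tsk j : (0 < j < k.+1)%N -> (val t * val s) ^+ j <> 1.
  move=> /stk + ts; apply.
  by apply: invg_inj; rewrite -expVgn invgM !sV ts invg1.
apply/reduced_cons; first by apply: IHk => j jk; apply: tsk; lia.
apply/negP => /linv_altw[i ik E]; case: (tsk i.+1); first lia.
by rewrite expgSr mulgA -E ss.
Qed.

(** The equality says [(s t)^n = 1]. If the order [m] were smaller, the prefix of length [m + 1]
    would equal an alternating word of length [m - 1], contradicting reducedness. *)
Lemma altw_order n s t :
  (0 < n)%N -> reduced (altw n s t) ->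
  wprod (altw n s t) = wprod (altw n t s) ->
  has_order (val s * val t) n.
Proof.
move=> n0 red E.
have exm : exists m, (0 < m)%N && ((val s * val t) ^+ m == 1).
  exists n; rewrite n0; apply/eqP; apply: (@mulIg _ (wprod (altw n t s))).
  by rewrite -wprod_altw mul1g.
case: (ex_minnP exm) => m /andP[m0 /eqP stm] mmin.
have ord : has_order (val s * val t) m.
  by split=> // j /andP[j0 jm] /eqP stj; have := mmin j; rewrite j0 stj; lia.
have : (m <= n)%N.
  apply: mmin; rewrite n0; apply/eqP; apply: (@mulIg _ (wprod (altw n t s))).
  by rewrite -wprod_altw mul1g.
rewrite leq_eqVlt => /orP[/eqP <- //|mn].
have [l El _] := altw_cat m.+1 (n - m.+1) s t.
move: red; rewrite -(subnKC mn) El.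
move=> /reduced_catl /reducedP /(_ (altw m.-1 t s)).
rewrite !size_altw; case: m m0 stm {mn ord mmin El} => // m _ stm /=.
have : wprod (altw m.+1 s t) = wprod (altw m.+1 t s).
  by rewrite wprod_altw stm mul1g.
rewrite /= !wprod_cons => <-; rewrite mulgA ss mul1g => /(_ erefl).
by lia.
Qed.

(** * Matsumoto's theorem *)

Section Matsumoto.
Variables (G : groupType) (f : S -> G).
Hypothesis braidf : forall s t m, s != t -> has_order (val s * val t) m ->
  \prod_(x <- altw m s t) f x = \prod_(x <- altw m t s) f x.

Local Notation fprod l := (\prod_(s <- l) f s).

(** By induction on the length, words with a common first or last letter are settled by cancelling
    it. Other pairs are linked through such words, unless two alternating words are reached, where
    the braid relation is used. *)
Theorem matsumoto l l' : reduced l -> wprod l' = wprod l -> size l' = size l ->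
  fprod l = fprod l'.
Proof.
move: {2}(size l) (erefl (size l)) => n.
elim: n l l' => [|n IHn] l l' szl redl E sz'.
  by move: l l' szl sz' {redl E} => [|//] [|//].
have same_head s u u' : reduced (s :: u) -> wprod (s :: u') = wprod (s :: u) ->
    size u = n -> size u' = n -> fprod (s :: u) = fprod (s :: u').
  move=> red; rewrite !wprod_cons => /mulgI Euu szu szu'.
  rewrite !big_cons; congr (_ * _); apply: IHn; rewrite ?szu //.
  exact: (reduced_catr (l := [:: s])).
have same_last s u u' : reduced (rcons u s) ->
    wprod (rcons u' s) = wprod (rcons u s) ->
    size u = n -> size u' = n -> fprod (rcons u s) = fprod (rcons u' s).
  move=> red; rewrite !wprod_rcons => /mulIg Euu szu szu'.
  rewrite !big_rcons /=; congr (_ * _); apply: IHn; rewrite ?szu //.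
  by apply: (reduced_catl (l' := [:: s])); rewrite cats1.
(* Exchanging the first letter [s] of one word into the other word [q] either
   keeps the last letter of [q], or shifts [q] by one letter, so that its
   alternating prefix grows. *)
have chain d : forall j s t x y, s != t -> reduced (s :: x) -> size x = n ->
    size y = d -> (d + j)%N = n ->
    wprod (altw j.+1 t s ++ y) = wprod (s :: x) ->
    fprod (s :: x) = fprod (altw j.+1 t s ++ y).
  elim/ltn_ind: d => d IHd j s t x y st redp szx szy dj Eq.
  set q := altw j.+1 t s ++ y in Eq *.
  have szq : size q = n.+1 by rewrite size_cat size_altw szy; lia.
  have redq : reduced q by apply: reduced_eq_size redp Eq _; rewrite szq /= szx.
  (* As [s :: x] is reduced, [s] is not an inversion of [x]; hence it is one of [q], which has the
     product of [s :: x]. *)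
  have sq : linv q (val s).
    rewrite (linv_wprod Eq) /= eqxx ss mul1g /=.
    exact: (proj1 (reduced_cons s (reduced_catr (l := [:: s]) redp)) redp).
  have [q1 [u [q2 [Eu Ex]]]] := linv_exchange sq.
  have szq12 : size (q1 ++ q2) = n.
    by move: szq; rewrite Eu !size_cat /= addnS; lia.
  have En : wprod (s :: q1 ++ q2) = wprod (s :: x).
    by rewrite wprod_cons -Ex mulgA ss mul1g Eq.
  have redn : reduced (s :: q1 ++ q2).
    by apply: (reduced_eq_size redp En); rewrite /= szq12 szx.
  rewrite (same_head _ _ _ redp En) //.
  case/lastP: q2 => [|q2 z] in Eu Ex szq12 En redn *; last first.
    have Eq' : q = rcons (q1 ++ u :: q2) z by rewrite Eu rcons_cat.
    have En' : s :: q1 ++ rcons q2 z = rcons (s :: q1 ++ q2) z.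
      by rewrite rcons_cons rcons_cat.
    rewrite Eq' in szq Eq *; rewrite En' in En redn *.
    move: szq szq12; rewrite !size_rcons !size_cat /= size_rcons.
    move=> -[szq] szq12; rewrite -rcons_cons; apply: same_last => //;
      by rewrite ?Eq /= ?size_cat //; lia.
  rewrite cats0 in szq12 En redn *; rewrite cats1 in Eu.
  move: En redn; rewrite (_ : fprod q = fprod (rcons q1 u)) -?Eu // => En redn.
  case/lastP: y => [|y z] in szy q Eq szq redq sq Eu Ex En *.
    (* Nothing follows the alternating prefix: both words are alternating of length [n.+1], which is
       then the order of [s t]. *)
    have jn : j = n by rewrite -dj -szy.
    have [q0 Eq0 sz0] := altw_cat j 1 t s.
    have Eq1 : q1 = altw j t s.
      move: Eu; rewrite addn1 in Eq0; rewrite /q cats0 Eq0.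
      by case: q0 sz0 {Eq0} => [//|z [|//]] _; rewrite cats1 => /rcons_inj[].
    rewrite Eq1 in redn En *.
    rewrite /q cats0 -[s :: _]/(altw j.+1 s t) in redn En Eq *.
    by apply: braidf st _; apply: altw_order => //; rewrite En Eq.
  have Eq1 : q1 = altw j.+1 t s ++ y.
    by move: Eu; rewrite /q -rcons_cat => /rcons_inj[].
  have Ed : (size y).+1 = d by rewrite -szy size_rcons.
  (* The two words trade places, as do [s] and [t]: [q] starts with [t], and [s :: q1] has an
     alternating prefix of length [j.+2]. *)
  rewrite Eq1 in En *; apply/esym; apply: (IHd (size y) _ j.+1 t s) => //.
  - by rewrite -Ed.
  - by rewrite eq_sym.
  - by case: szq.
  - by rewrite addnS -addSn Ed.
  - by rewrite [wprod (t :: _)]Eq -En.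
case: l l' szl sz' redl E => [//|s x] [//|t y] /= [szx] [szy] redl E.
have [Est|st] := eqVneq s t; first by subst t; apply: same_head; rewrite // szy.
by apply: (chain n 0 s t x y); rewrite ?addn0 // szy.
Qed.
End Matsumoto.

End CoxeterCombinatorics.

(** * Inversions of group elements and descents *)

Section Inversions.
Variables (W : groupType) (S : set W).
Hypothesis coxS : coxeter_system S.
Implicit Types (s t : S) (l : seq S) (r v w : W).
Local Open Scope group_scope.

(** At [val s] this tests whether [s] is a left descent of [w]; applied to [w^-1] it tests right
    descents. *)
Definition winv w r : bool := linv (reduced_word S w) r.

Lemma wprod_reduced_word w : \prod_(s <- reduced_word S w) val s = w.
Proof. by case: (reduced_wordP coxS w). Qed.

Lemma reduced_reduced_word w : reduced (reduced_word S w).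
Proof. by rewrite /reduced wprod_reduced_word; apply: reduced_wordP. Qed.

Lemma winv_wprod l r : winv (\prod_(s <- l) val s) r = linv l r.
Proof. by apply: linv_wprod; rewrite ?wprod_reduced_word. Qed.

Lemma winvM v w r : winv (v * w) r = winv v r (+) winv w (v^-1 * r * v).
Proof.
rewrite -[v in LHS]wprod_reduced_word -[w in LHS]wprod_reduced_word -big_cat.
by rewrite winv_wprod linv_cat // wprod_reduced_word.
Qed.

Lemma winv_gen s r : winv (val s) r = (r == val s).
Proof. by have := winv_wprod [:: s] r; rewrite big_seq1 /= addbF. Qed.

Lemma winv1 r : winv 1 r = false.
Proof. by have := winv_wprod [::] r; rewrite big_nil. Qed.

Lemma ldesc_mull s w : winv (val s * w) (val s) = ~~ winv w (val s).
Proof. by rewrite winvM winv_gen eqxx mulVg mul1g. Qed.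

(** In the cocycle rule [winvM] the second term tests [w^-1 s w = t], so only then does right
    multiplication by [t] affect the left descent at [s]. *)
Lemma ldesc_mulr s t w :
  winv (w * val t) (val s) = winv w (val s) (+) (val s * w == w * val t).
Proof.
rewrite winvM winv_gen; congr (_ (+) _).
apply/eqP/eqP => [<-|E]; first by rewrite !mulgA mulgV mul1g.
by rewrite -mulgA E mulKg.
Qed.

Lemma rdesc_mull s t w :
  winv (val s * w)^-1 (val t) = winv w^-1 (val t) (+) (val s * w == w * val t).
Proof.
rewrite invgM (coxeter_inv coxS) ldesc_mulr; congr (_ (+) _).
rewrite -[X in X == _]invgK (inv_eq invgK) !invgM !(coxeter_inv coxS) invgK.
by rewrite eq_sym.
Qed.

Lemma reduced_rcons l s :
  reduced (rcons l s) -> reduced l /\ ~~ winv (\prod_(s <- l) val s)^-1 (val s).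
Proof.
move=> red; have redl : reduced l.
  by apply: (reduced_catl (l' := [:: s])); rewrite cats1.
split=> //; rewrite -wprod_rev // winv_wprod.
apply: (proj1 (reduced_cons coxS s (reduced_rev coxS redl))).
by rewrite -rev_rcons; apply: reduced_rev.
Qed.

End Inversions.

(** * Operators on functions modelled on left and right multiplication *)

Section Operators.
Variables (k A : comPzRingType) (eta : {rmorphism k -> A}).
Variables (W : groupType) (S : set W) (rho : W -> A -> A) (a : S -> A).
Hypotheses (coxS : coxeter_system S) (actA : alg_action eta rho).
Hypotheses (unit_a : forall s, invertible (a s)) (equi_a : equivariant rho a).
Implicit Types (s t : S) (l : seq S) (w : W) (c d : A) (f : W -> A).

Local Notation rs s := (rho (val s)).

Lemma rhoB w c d : rho w (c - d) = rho w c - rho w d.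
Proof.
suff rhoN : rho w (- d) = - rho w d by rewrite (alg_action_add actA) rhoN.
have rho0 : rho w 0 = 0.
  by apply: (@addrI _ (rho w 0)); rewrite -(alg_action_add actA) !addr0.
by apply: (@addrI _ (rho w d)); rewrite -(alg_action_add actA) !subrr.
Qed.

Lemma rho_gen_a s : rs s (a s) = a s.
Proof. by apply: equi_a; rewrite mulgK. Qed.

Lemma rho_genK s c : rs s (rs s c) = c.
Proof.
by rewrite -(alg_actionM actA) (coxeter_sqr coxS) (alg_action1 actA).
Qed.

(* On delta functions, [left_op s] sends [d_w] to [a_s d_(sw)] if [l(sw) > l(w)]
   and to [d_(sw) + (1 - a_s) d_w] otherwise: this is left multiplication by
   [g_s] with each [g_w] rescaled by a unit, chosen so that no [a_s] occurs when
   an ascending product is evaluated at 1. *)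
Definition left_op s f w : A :=
  if winv S w (val s) then a s * rs s (f (val s * w)%g) + (1 - a s) * rs s (f w)
  else rs s (f (val s * w)%g).

(** Right multiplication is [A]-linear, so no [rho] is applied to the values of [f]; the scalar
    [a t] becomes [rho w (a t)] on being moved to the left of [g_w]. *)
Definition right_op t f w : A :=
  if winv S (w^-1)%g (val t)
  then rho w (a t) * f (w * val t)%g + (1 - rho w (a t)) * f w
  else f (w * val t)%g.

Lemma left_opD s f g w :
  left_op s (fun v => f v + g v) w = left_op s f w + left_op s g w.
Proof. by rewrite /left_op !(alg_action_add actA); case: ifP => // _; ring. Qed.

Lemma left_opZ s c f w :
  left_op s (fun v => c * f v) w = rs s c * left_op s f w.
Proof. by rewrite /left_op !(alg_action_mul actA); case: ifP => // _; ring. Qed.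

Local Notation M := (W -> A).

(** * Quadratic, commutation and braid relations for the operators *)

Section Action.
Hypothesis a_rho : forall s c, (1 - a s) * (c - rs s c) = 0.

Lemma a_rhoE s c : (1 - a s) * rs s c = (1 - a s) * c.
Proof. by apply/eqP; rewrite eq_sym -subr_eq0 -mulrBr a_rho. Qed.

(** The applications of [rho] cancel in pairs except under the factor [1 - a s], where [a_rho]
    allows one to be dropped. *)
Lemma left_op_sqr s f w :
  left_op s (left_op s f) w = a s * f w + (1 - a s) * left_op s f w.
Proof.
rewrite /left_op ldesc_mull //.
rewrite !mulgA (coxeter_sqr coxS) mul1g; case: (winv S w _) => /=.
  by rewrite rho_genK a_rhoE.
by rewrite !(rhoB, alg_action_add actA, alg_action_mul actA, alg_action_one actA)
  !rho_gen_a !rho_genK a_rhoE.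
Qed.

(** If [s w] differs from [w t], the left and right descents do not interact, and the coefficients
    differ only by a [rho] under the factor [1 - a s]. If [s w = w t], equivariance gives
    [rho w (a t) = a s]. *)
Lemma left_right_op s t f w :
  left_op s (right_op t f) w = right_op t (left_op s f) w.
Proof.
rewrite /left_op /right_op ldesc_mulr // rdesc_mull //.
have rb : rs s (rho (val s * w)%g (a t)) = rho w (a t).
  by rewrite (alg_actionM actA) rho_genK.
have sb := a_rhoE s (rho w (a t)).
have sbF (x y : A) :
    (1 - a s) * (rs s (rho w (a t)) * x + (1 - rs s (rho w (a t))) * y) =
    (1 - a s) * (rho w (a t) * x + (1 - rho w (a t)) * y).
  transitivity ((1 - a s) * rs s (rho w (a t)) * (x - y) + (1 - a s) * y).
    by ring.
  by rewrite sb; ring.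
have rhoE :=
  (rhoB, alg_action_add actA, alg_action_mul actA, alg_action_one actA).
case: eqP => [E|_]; last first.
  by rewrite !addbF !mulgA; case: (winv S w _); case: (winv S _ _) => /=;
     rewrite ?rhoE ?rb ?rho_gen_a ?rho_genK ?sbF; ring.
have ta : rho w (a t) = a s by apply: equi_a; rewrite -E mulgK.
(* The cocycle rule for [w^-1 w = 1] identifies the two descents. *)
have -> : winv S (w^-1)%g (val t) = winv S w (val s).
  have := winvM coxS (w^-1)%g w (val t).
  rewrite mulVg winv1 // invgK -E mulgK.
  by case: (winv _ _ _); case: (winv _ _ _).
have sE : (val s * w * val t)%g = w.
  by rewrite -mulgA -E mulgA (coxeter_sqr coxS) mul1g.
rewrite -E !mulgA (coxeter_sqr coxS) mul1g sE.
by case: (winv S w _) => /=; rewrite ?rhoE ?rb ?ta ?rho_gen_a ?rho_genK.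
Qed.

Lemma left_op_bij s :
  {h : M -> M | cancel (left_op s) h & cancel h (left_op s)}.
Proof.
have [b ab] := cid (unit_a s).
have ba : rs s b = b.
  have := congr1 (fun c => b * rs s c) ab.
  rewrite /= (alg_action_mul actA) (alg_action_one actA) rho_gen_a mulr1.
  by rewrite mulrA [b * _]mulrC ab mul1r.
(* With [b] the inverse of [a s], the relation [T^2 = a + (1 - a) T] gives
   [T^-1 = b (T + a - 1)]. *)
exists (fun f w => b * left_op s f w + b * (a s - 1) * f w) => f;
  apply/funext => w.
  rewrite left_op_sqr.
  rewrite [RHS](_ : _ = a s * b * f w); last by rewrite ab mul1r.
  by ring.
rewrite left_opD !left_opZ left_op_sqr (alg_action_mul actA) rhoB.
rewrite (alg_action_one actA) ba rho_gen_a.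
by rewrite [RHS](_ : _ = a s * b * f w); [ring | rewrite ab mul1r].
Qed.

Definition left_bij s : bijection M :=
  let: exist2 h fK Kf := left_op_bij s in Bijection fK Kf.

Lemma left_bijE s f : left_bij s f = left_op s f.
Proof. by rewrite /left_bij; case: left_op_bij. Qed.

Definition semilinear (v : W) (h : M -> M) : Prop :=
  (forall f g, h (fun w => f w + g w) = (fun w => h f w + h g w)) /\
  (forall c f, h (fun w => c * f w) = (fun w => rho v c * h f w)).

Lemma semilinear_comp v v' (h h' : M -> M) :
  semilinear v h -> semilinear v' h' -> semilinear (v * v')%g (h \o h').
Proof.
move=> [hD hZ] [hD' hZ']; split=> [f g|c f] /=; first by rewrite hD' hD.
by rewrite hZ' hZ (alg_actionM actA).
Qed.

Lemma semilinearV v (h : bijection M) :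
  semilinear v h -> semilinear (v^-1)%g (h^-1)%g.
Proof.
move=> [hD hZ]; split=> [f g|c f]; rewrite bijV; apply: (can_inj (bij_funK h)).
  by rewrite hD !bij_invK.
by rewrite hZ !bij_invK -(alg_actionM actA) mulgV (alg_action1 actA).
Qed.

(** Stated for expressions because [artin_proj] and [artin_act] evaluate the same representative of
    a braid. *)
Lemma semilinear_geval (u : gexpr S) :
  semilinear (geval (fun s : S => val s) u) (geval left_bij u).
Proof.
elim: u => [s||u IHu v IHv|u IHu] /=.
- split=> [f g|c f]; rewrite !left_bijE; apply/funext => w.
    exact: left_opD.
  exact: left_opZ.
- by split=> // c f; apply/funext => w; rewrite (alg_action1 actA).
- exact: semilinear_comp.
- exact: semilinearV.
Qed.

Lemma left_bij_rcons l s f :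
  (\prod_(s <- rcons l s) left_bij s)%g f =
  (\prod_(s <- l) left_bij s)%g (left_op s f).
Proof. by rewrite big_rcons /= left_bijE. Qed.

(** Peeling off the last letter [s] evaluates [left_op s] at the inverse of the remaining prefix,
    which does not have [s] as a left descent; so only the branch without [a s] occurs. *)
Lemma reduced_left_bij l f : reduced l ->
  (\prod_(s <- l) left_bij s)%g f 1%g =
  rho (\prod_(s <- l) val s)%g (f ((\prod_(s <- l) val s)^-1)%g).
Proof.
elim/last_ind: l f => [|l s IHl] f.
  by rewrite !big_nil bij1 invg1 (alg_action1 actA).
move=> /(reduced_rcons coxS)[redl Ns]; rewrite left_bij_rcons IHl // big_rcons.
rewrite /left_op (negbTE Ns) -(alg_actionM actA) invgM.
by rewrite (coxeter_inv coxS).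
Qed.

Lemma left_bij_right_op l t f :
  (\prod_(s <- l) left_bij s)%g (right_op t f) =
  right_op t ((\prod_(s <- l) left_bij s)%g f).
Proof.
elim: l => [|s l IHl]; first by rewrite !big_nil.
rewrite !big_cons !bijM IHl !left_bijE; apply/funext => w.
exact: left_right_op.
Qed.

(* The right operators carry the value at [1] to the value at any [w]. *)
Lemma left_bij_determined l l' :
  (forall f, (\prod_(s <- l) left_bij s)%g f 1%g =
             (\prod_(s <- l') left_bij s)%g f 1%g) ->
  (\prod_(s <- l) left_bij s)%g = (\prod_(s <- l') left_bij s)%g.
Proof.
move=> E1; apply: bijectionP => f; apply/funext => w.
rewrite -(wprod_reduced_word coxS w).
elim/last_ind: {w}(reduced_word S w) (reduced_reduced_word coxS w) f =>
  [|u t IHu] redu f.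
  by rewrite big_nil E1.
have [{}redu Nt] := reduced_rcons coxS redu.
have Et g : g (\prod_(s <- rcons u t) val s)%g =
    right_op t g (\prod_(s <- u) val s)%g.
  by rewrite /right_op (negbTE Nt) big_rcons.
by rewrite !Et -!left_bij_right_op IHu.
Qed.

(** Both alternating words are reduced expressions of one element, so their operators agree at 1,
    which determines them. *)
Lemma left_bij_braid (u v : gexpr S) :
  braid_rel u v -> geval left_bij u = geval left_bij v.
Proof.
case=> s t m _ st_m; rewrite !alternatingE !geval_word_expr.
have [_ stm stj] := st_m.
have Ew : (\prod_(x <- altw m s t) val x = \prod_(x <- altw m t s) val x)%g.
  by rewrite (wprod_altw coxS) stm mul1g.
have red : reduced (altw m s t) by apply: altw_reduced.
apply: left_bij_determined => f; rewrite !reduced_left_bij ?Ew //.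
by apply: reduced_eq_size red _ _; rewrite ?size_altw.
Qed.

(** * Descent of the action to the braid group, the semidirect product and the Marin ideal *)

Local Notation B := (artin_group S).

Definition artin_act (g : B) : bijection M := pg_lift left_bij g.

Lemma artin_actM g h : artin_act (g * h)%g = (artin_act g * artin_act h)%g.
Proof. exact: pg_liftM left_bij_braid _ _. Qed.

Lemma artin_act1 : artin_act 1%g = 1%g.
Proof. exact: pg_lift1 left_bij_braid. Qed.

Lemma artin_act_gen s : artin_act (artin_gen s) = left_bij s.
Proof. exact: pg_lift_gen left_bij_braid _. Qed.

Lemma semilinear_artin_act g : semilinear (artin_proj g) (artin_act g).
Proof. exact: semilinear_geval. Qed.

Fixpoint alg_act (u : aexpr k (A + B)) (f : M) : M :=
  match u with
  | AVar (inl c) => fun w => c * f w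
  | AVar (inr g) => artin_act g f
  | AScal z => fun w => eta z * f w
  | AAdd u v => fun w => alg_act u f w + alg_act v f w
  | AMul u v => alg_act u (alg_act v f)
  end.

Lemma alg_actD u f g :
  alg_act u (fun w => f w + g w) = (fun w => alg_act u f w + alg_act u g w).
Proof.
elim: u f g => [[c|h]|z|u IHu v IHv|u IHu v IHv] f g /=; try apply/funext => w.
- exact: mulrDr.
- by rewrite (semilinear_artin_act h).1.
- exact: mulrDr.
- by rewrite IHu IHv addrACA.
- by rewrite IHv IHu.
Qed.

Lemma alg_actZ u z f :
  alg_act u (fun w => eta z * f w) = (fun w => eta z * alg_act u f w).
Proof.
elim: u f => [[c|h]|z'|u IHu v IHv|u IHu v IHv] f /=; try apply/funext => w.
- exact: mulrCA.
- by rewrite (semilinear_artin_act h).2 (alg_action_scal actA).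
- exact: mulrCA.
- by rewrite IHu IHv mulrDr.
- by rewrite IHv IHu.
Qed.

Lemma alg_act_cong (u v : aexpr k (A + B)) :
  acong (semidirect_rel eta rho) u v -> alg_act u = alg_act v.
Proof.
move=> uv; apply/funext => f.
elim: uv f => {u v} /=; try by [move=> *; apply/funext => w /=; ring].
- move=> _ _ [c d|c d||z|g h||g c] f /=; try by [apply/funext => w /=; ring].
  + by rewrite artin_actM.
  + by rewrite artin_act1; apply/funext => w; rewrite rmorph1 mul1r.
  + by rewrite (semilinear_artin_act g).2.
- by move=> u v _ uv f; rewrite uv.
- by move=> u v w _ uv _ vw f; rewrite uv vw.
- by move=> u u' v v' _ uE _ vE f; apply/funext => w; rewrite uE vE.
- by move=> u u' v v' _ uE _ vE f; rewrite vE uE.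
- by move=> u f; congr (alg_act u _); apply/funext => w; rewrite rmorph1 mul1r.
- by move=> u v w f; rewrite alg_actD.
- by move=> z u f; rewrite alg_actZ.
Qed.

Definition sd_act (x : semidirect eta S rho) : M -> M := alg_act (repr x).

Lemma sd_act_class u : sd_act (pa_class _ u) = alg_act u.
Proof. exact/alg_act_cong/repr_pa_class. Qed.

Lemma sd_act_A c f : sd_act (sd_A eta S rho c) f = (fun w => c * f w).
Proof. by rewrite sd_act_class. Qed.

Lemma sd_act_B g f : sd_act (sd_B eta rho g) f = artin_act g f.
Proof. by rewrite sd_act_class. Qed.

Lemma sd_actD x y f w : sd_act (x + y) f w = sd_act x f w + sd_act y f w.
Proof.
by rewrite -[x]pa_classK -[y]pa_classK -pa_classD !sd_act_class.
Qed.

Lemma sd_actM x y f : sd_act (x * y) f = sd_act x (sd_act y f).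
Proof.
by rewrite -[x]pa_classK -[y]pa_classK -pa_classM !sd_act_class.
Qed.

Lemma sd_act0 f w : sd_act 0 f w = 0.
Proof. by rewrite sd_act_class /= rmorph0 mul0r. Qed.

Lemma sd_actN x f w : sd_act (- x) f w = - sd_act x f w.
Proof. by apply/eqP; rewrite -subr_eq0 opprK -sd_actD addNr sd_act0. Qed.

Lemma sd_act1 f : sd_act 1 f = f.
Proof. by rewrite sd_act_class; apply/funext => w /=; rewrite rmorph1 mul1r. Qed.

Lemma sd_act_ideal x : ideal2 (@marin_rel k A eta W S rho a) x ->
  forall f w, sd_act x f w = 0.
Proof.
elim=> {x} [_ [s /=]||x y _ IHx _ IHy|r x _ IHx|r x _ IHx] f w.
- rewrite !(sd_actD, sd_actN) expr2 !sd_actM !(sd_actD, sd_actN) sd_act1.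
  rewrite !sd_act_A !sd_act_B artin_act_gen !left_bijE left_op_sqr.
  by ring.
- exact: sd_act0.
- by rewrite sd_actD IHx IHy addr0.
(* Writing the zero function as [sd_act 0 f] lets [mulr0] show that [sd_act r] kills it. *)
- rewrite sd_actM (_ : sd_act x f = sd_act 0 f); last first.
    by apply/funext => v; rewrite IHx sd_act0.
  by rewrite -sd_actM mulr0 sd_act0.
- by rewrite sd_actM IHx.
Qed.

End Action.

(** * Multiplication rules in the Marin ring *)

Local Notation E := (marin eta rho a).
Local Notation cl := (@marin_class k A eta W S rho a).
Local Notation G s := (marin_gen eta rho a s : E).
Local Notation basis := (marin_basis eta rho a).

Lemma sd_BM g h :
  sd_B eta rho (g * h)%g = sd_B eta rho g * sd_B eta rho h :> semidirect eta S rho.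
Proof.
by rewrite /sd_B /pa_gen -pa_classM; apply/pa_classP/acong_rel; constructor.
Qed.

Lemma sd_B1 : sd_B eta rho 1%g = 1 :> semidirect eta S rho.
Proof. by apply/pa_classP/acong_rel; constructor. Qed.

Lemma sd_BA g c :
  sd_B eta rho g * sd_A eta S rho c =
  sd_A eta S rho (rho (artin_proj g) c) * sd_B eta rho g.
Proof.
rewrite /sd_B /sd_A /pa_gen -!pa_classM.
by apply/pa_classP/acong_rel; constructor.
Qed.

Lemma sd_A_eta z : sd_A eta S rho (eta z) = pa_scal _ z.
Proof. by apply/pa_classP/acong_rel; constructor. Qed.

Lemma marin_classM x y : cl (x * y) = (cl x * cl y : E).
Proof. exact: q2_classM. Qed.

Lemma marin_classD x y : cl (x + y) = (cl x + cl y : E).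
Proof. exact: q2_classD. Qed.

Lemma marin_scaleE c (y : E) : c *: y = cl (sd_A eta S rho c) * y.
Proof. by []. Qed.

Lemma marin_genZ s c (y : E) : G s * (c *: y) = rs s c *: (G s * y).
Proof.
rewrite !marin_scaleE !mulrA; congr (_ * _).
by rewrite -!marin_classM sd_BA artin_proj_gen.
Qed.

Lemma marin_gen_sqr s (y : E) :
  G s * (G s * y) = a s *: y + (1 - a s) *: (G s * y).
Proof.
have sdB : 1 - sd_A eta S rho (a s) = sd_A eta S rho (1 - a s).
  apply/eqP; rewrite subr_eq; apply/eqP/esym.
  have -> : 1 = sd_A eta S rho 1 by apply/esym/pa_classP/acong_rel; constructor.
  rewrite -[in RHS](subrK (a s) 1) /sd_A /pa_gen -pa_classD.
  by apply/esym/pa_classP/acong_rel; constructor.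
have -> : G s * (G s * y) =
    cl (sd_B eta rho (artin_gen s) * sd_B eta rho (artin_gen s)) * y.
  by rewrite marin_classM mulrA.
have -> : cl (sd_B eta rho (artin_gen s) * sd_B eta rho (artin_gen s)) =
    cl (sd_A eta S rho (a s) +
        sd_A eta S rho (1 - a s) * sd_B eta rho (artin_gen s)).
  apply/q2_classP/ideal2_gen; rewrite opprD addrA -expr2 -sdB.
  by constructor.
by rewrite marin_classD marin_classM mulrDl -mulrA.
Qed.

Lemma marin_gen_word l :
  \prod_(s <- l) G s = cl (sd_B eta rho (\prod_(s <- l) artin_gen s)%g).
Proof.
elim: l => [|s l IHl]; first by rewrite !big_nil sd_B1.
by rewrite !big_cons IHl sd_BM marin_classM.
Qed.

(** Matsumoto's theorem is stated for maps to a group, so it is applied in the Artin group and the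
    result is carried to the quotient. *)
Lemma marin_basis_reduced l : reduced l ->
  \prod_(s <- l) G s = basis (\prod_(s <- l) val s)%g.
Proof.
move=> redl; rewrite /marin_basis !marin_gen_word; congr (cl (sd_B _ _ _)).
set w := (\prod_(s <- l) val s)%g; have wl := wprod_reduced_word coxS w.
have redw := reduced_reduced_word coxS w.
apply: (matsumoto coxS) => //; last first.
  apply/eqP; rewrite eqn_leq; move/reducedP: (redl) => /(_ _ wl) ->.
  by move/reducedP: redw => /(_ l); rewrite wl => ->.
move=> s t m st st_m; rewrite -!geval_word_expr -!alternatingE.
have cE u : geval (artin_gen (S := S)) u = pg_class _ u.
  elim: u => [x||u1 IH1 u2 IH2|u1 IH1] //=; first by rewrite IH1 IH2 -pg_mulE.
  by rewrite IH1 -pg_invE.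
by rewrite !cE; apply/pg_classP/gcong_rel; constructor.
Qed.

Lemma marin_basis1 : basis 1%g = 1.
Proof.
by have := marin_basis_reduced (reduced_nil S); rewrite !big_nil => <-.
Qed.

Lemma marin_gen_basis s w :
  ~~ winv S w (val s) -> G s * basis w = basis (val s * w)%g.
Proof.
move=> Nsw; have red : reduced (s :: reduced_word S w).
  exact/(reduced_cons coxS)/Nsw/reduced_reduced_word.
by have := marin_basis_reduced red; rewrite !big_cons wprod_reduced_word.
Qed.

Lemma marin_basis_gen s : basis (val s) = G s.
Proof.
by rewrite -[val s]mulg1 -marin_gen_basis ?winv1 // marin_basis1 mulr1.
Qed.

(** * Spanning *)

Definition in_span (x : E) : Prop :=
  exists p : seq (A * W), x = \sum_(q <- p) q.1 *: basis q.2.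

Lemma in_span0 : in_span 0.
Proof. by exists [::]; rewrite big_nil. Qed.

Lemma in_spanD x y : in_span x -> in_span y -> in_span (x + y).
Proof. by move=> [p ->] [q ->]; exists (p ++ q); rewrite big_cat. Qed.

Lemma in_spanZ c x : in_span x -> in_span (c *: x).
Proof.
move=> [p ->]; exists [seq (c * q.1, q.2) | q <- p].
by rewrite big_map scaler_sumr; apply: eq_bigr => q _; rewrite scalerA.
Qed.

Lemma in_span_basis w : in_span (basis w).
Proof. by exists [:: (1, w)]; rewrite big_seq1 scale1r. Qed.

(** At a descent, [g_w = g_s g_(sw)] and the quadratic relation applies. *)
Lemma in_span_gen s x : in_span x -> in_span (G s * x).
Proof.
move=> [p ->]; rewrite mulr_sumr; apply: (big_ind _ in_span0 in_spanD) => q _.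
rewrite marin_genZ; apply: in_spanZ; case: (boolP (winv S q.2 (val s))) => sq.
  have sq' : ~~ winv S (val s * q.2)%g (val s) by rewrite ldesc_mull // sq.
  have := marin_gen_basis sq'; rewrite mulgA (coxeter_sqr coxS) mul1g => <-.
  rewrite marin_gen_sqr; apply: in_spanD; apply: in_spanZ.
    exact: in_span_basis.
  by rewrite marin_gen_basis //; apply: in_span_basis.
by rewrite marin_gen_basis //; apply: in_span_basis.
Qed.

Lemma in_span_genV s x :
  in_span x -> in_span (cl (sd_B eta rho (artin_gen s)^-1%g) * x).
Proof.
move=> spx; set z : E := _ * x; have [b ab] := cid (unit_a s).
have Gz : G s * z = x.
  by rewrite /z mulrA -marin_classM -sd_BM mulgV sd_B1 [cl 1]q2_class1 mul1r.
have -> : z = b *: (G s * x - (1 - a s) *: x).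
  by rewrite -Gz marin_gen_sqr addrK scalerA mulrC ab scale1r.
apply/in_spanZ/in_spanD; first exact: in_span_gen.
by rewrite -scaleNr; apply: in_spanZ.
Qed.

Lemma in_span_artin (g : artin_group S) x :
  in_span x -> in_span (cl (sd_B eta rho g) * x).
Proof.
rewrite -[g]pg_classK; move: (repr g) x => u {g}.
(* Inverses are carried along so that the induction passes through [GInv]. *)
suff [] : (forall x, in_span x ->
             in_span (cl (sd_B eta rho (pg_class _ u)) * x)) /\
          (forall x, in_span x ->
             in_span (cl (sd_B eta rho (pg_class _ u)^-1%g) * x)) by [].
have pgM u1 u2 : pg_class (braid_rel (S := S)) (GMul u1 u2) =
   (pg_class _ u1 * pg_class _ u2)%g by rewrite -pg_mulE.
have pgV u1 : pg_class (braid_rel (S := S)) (GInv u1) = ((pg_class _ u1)^-1)%g.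
  by rewrite -pg_invE.
elim: u => [s||u [IHu IHu'] v [IHv IHv']|u [IHu IHu']].
- by split=> x; [apply: in_span_gen | apply: in_span_genV].
- rewrite -[pg_class _ _]/(1%g : artin_group S) invg1 sd_B1.
  by split=> x; rewrite [cl 1]q2_class1 mul1r.
- rewrite pgM invgM !sd_BM !marin_classM.
  by split=> x spx; rewrite -mulrA; [apply/IHu/IHv | apply/IHv'/IHu'].
- by rewrite pgV invgK.
Qed.

Lemma in_span_mul (x y : E) : in_span y -> in_span (x * y).
Proof.
elim/q2_classW: x => x; elim/pa_classW: x => u; rewrite -[q2_class _ _]/(cl _).
elim: u y => [[c|g]|z|u IHu v IHv|u IHu v IHv] y spy.
- exact: in_spanZ.
- exact: in_span_artin.
- by rewrite -[pa_class _ _]/(pa_scal _ z) -sd_A_eta; apply: in_spanZ.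
- rewrite pa_classD marin_classD mulrDl.
  by apply: in_spanD; [apply: IHu | apply: IHv].
- by rewrite pa_classM marin_classM -mulrA; apply/IHu/IHv.
Qed.

Lemma marin_basis_spanning : spanning basis.
Proof.
move=> x; have [p ->] : in_span x.
  by rewrite -[x]mulr1 -marin_basis1; apply/in_span_mul/in_span_basis.
(* The list [p] may repeat elements of [W]; their coefficients are collected here. *)
exists (undup [seq q.2 | q <- p]), (fun w => \sum_(q <- p | q.2 == w) q.1).
under [RHS]eq_bigr do rewrite scaler_suml.
rewrite (exchange_big_dep xpredT) //= big_seq [RHS]big_seq.
apply: eq_bigr => q pq.
rewrite (eq_bigl (pred1 q.2)) => [|w]; last exact: eq_sym.
rewrite -big_filter filter_pred1_uniq ?undup_uniq ?big_seq1 // mem_undup.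
exact: map_f.
Qed.

(** * Independence, and necessity of the condition *)

Lemma marin_basis_free :
  (forall s c, (1 - a s) * (c - rs s c) = 0) -> lin_indep basis.
Proof.
move=> a_rho s c us sum0 v vs.
(* The action is defined on the semidirect product, so the relation is lifted there; the lift lies
   in the Marin ideal and acts as zero. *)
pose x := \sum_(w <- s) sd_A eta S rho (c w) *
  sd_B eta rho (\prod_(t <- reduced_word S w) artin_gen t)%g.
have clx : cl x = cl 0.
  rewrite -[cl 0]sum0 /x.
  elim: (s) => [|w s' IHs]; first by rewrite !big_nil.
  rewrite !big_cons marin_classD marin_classM IHs.
  by rewrite /marin_basis marin_gen_word.
move/q2_classP: clx; rewrite subr0 => /(sd_act_ideal a_rho).
have actx f : sd_act a_rho x f 1%g = \sum_(w <- s) c w * rho w (f w^-1%g).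
  rewrite /x; elim: (s) => [|w s' IHs]; first by rewrite !big_nil sd_act0.
  rewrite !big_cons sd_actD IHs sd_actM sd_act_A sd_act_B.
  have -> : artin_act a_rho (\prod_(t <- reduced_word S w) artin_gen t)%g =
      (\prod_(t <- reduced_word S w) left_bij a_rho t)%g.
    elim: (reduced_word S w) => [|t l IHl].
      by rewrite !big_nil artin_act1.
    by rewrite !big_cons artin_actM IHl artin_act_gen.
  rewrite reduced_left_bij ?wprod_reduced_word //.
  exact: reduced_reduced_word.
(* Acting on the delta function at [v^-1] and evaluating at 1 isolates [c v]. *)
move=> /(_ (fun w => (w == v^-1)%g%:R) 1%g).
rewrite actx (bigD1_seq v) //= eqxx (alg_action_one actA) mulr1.
rewrite big1 ?addr0 // => w wv.
rewrite (inj_eq invg_inj) (negbTE wv) /=.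
by have := rhoB w 0 0; rewrite subrr => ->; rewrite subrr mulr0.
Qed.

Lemma marin_basis_commute :
  lin_indep basis -> forall s c, (1 - a s) * (c - rs s c) = 0.
Proof.
move=> free s c.
have : ((1 - a s) * (c - rs s c)) *: G s = 0.
  (* One side moves [c] past both factors [g_s] before squaring, the other squares first; the terms
     without [g_s] cancel. *)
  have := marin_gen_sqr s (c *: (1 : E)).
  rewrite !marin_genZ marin_gen_sqr rho_genK scalerDr !scalerA.
  rewrite [c * a s]mulrC mulr1.
  move/addrI/eqP; rewrite -subr_eq0 -scalerBl => /eqP <-; congr (_ *: _).
  by ring.
move=> sum0.
apply: (free [:: val s] (fun=> (1 - a s) * (c - rs s c))) (val s) _ => //.
  by rewrite big_seq1 marin_basis_gen.
exact: mem_head.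
Qed.

End Operators.

Theorem corollary2p16 (k : comPzRingType) (W : groupType) (S : set W)
    (A : comPzRingType) (eta : {rmorphism k -> A})
    (rho : W -> A -> A) (a : S -> A) :
  coxeter_system S ->
  alg_action eta rho ->
  (forall s : S, invertible (a s)) ->
  equivariant rho a ->
  free_module (alg_module eta) ->
  (is_basis (marin_basis eta rho a) <->
   forall (s : S) (c : A), (1 - a s) * (c - rho (val s) c) = 0).
Proof.
move=> coxS actA unit_a equi_a _; split=> [[free _]|a_rho].
  exact: marin_basis_commute coxS actA free.
split; first exact: marin_basis_free coxS actA unit_a equi_a a_rho.
exact: marin_basis_spanning coxS unit_a.
Qed.
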